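(* If $X$ is a simple non-associative algebra over a field $\mathbf F$ (respectively a simple quasiring) such that $X$ is not finitely generated, then there exist a simple non-associative algebra over $\mathbf F$ (respectively a simple quasiring) $K$ and an embedding $X\hookrightarrow K$ such that $X$ is not isomorphic with $K$.
   Context: A groupoid is a set with a binary operation. A quasigroup is a groupoid with a neutral element in which each equation $ax=b$ or $xa=b$ has a solution. A quasiring is a set $K$ with two operations $+$ and $\times$ such that $K$ under $+$ and $K\setminus\{0\}$ under $\times$ are quasigroups or groupoids with neutral elements, with neutral elements $0$ and $1$ respectively, $a0=0a=0$ for all $a\in K$, and at least one of the left distributivity $a(b+c)=ab+ac$ or the right distributivity $(b+c)a=ba+ca$ holds for all $a,b,c\in K$. A non-associative ring is a quasiring which is a group under addition and for which $K\setminus\{0\}$ is a quasigroup under multiplication. A non-associative algebra over a field $\mathbf F$ is a non-associative ring that is also a linear space over $\mathbf F$ with $\alpha(a+b)=\alpha a+\alpha b$, $1a=a$, $\alpha(ab)=(\alpha a)b=a(\alpha b)$, $(\alpha\beta)a=\alpha(\beta a)$ for $\alpha,\beta\in\mathbf F$, $a,b\in K$. An ideal of $K$ is a subalgebra (respectively subquasiring) $A$ with $AK\subseteq A$ and $KA\subseteq A$, where $AB=\{ab: a\in A, b\in B\}$. $K$ is simple if $K\neq\{0\}$ and $K$ has no ideals other than $\{0\}$ and $K$. $K$ is not finitely generated if for each finite family $a_1,\dots,a_m\in K$ the minimal subquasiring (respectively minimal subalgebra over $\mathbf F$) containing $a_1,\dots,a_m$ is different from $K$. *)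

(* Defs.v *)
From HB Require Import structures.
From mathcomp Require Import all_boot all_order all_algebra.
From mathcomp Require Import boolp classical_sets.

Set Implicit Arguments.
Unset Strict Implicit.
Unset Printing Implicit Defensive.

Import GRing.Theory.
Local Open Scope classical_set_scope.
Local Open Scope ring_scope.

(** * Groupoids and quasigroups

    A groupoid is carried by a subset [D] of an ambient type, so that the same
    notions apply to [K] under addition and to [K \ {0}] under multiplication. *)

Definition groupoid_on (T : Type) (D : set T) (op : T -> T -> T) : Prop :=
  forall a b, D a -> D b -> D (op a b).

Definition neutral_on (T : Type) (D : set T) (op : T -> T -> T) (e : T) : Prop :=
  D e /\ forall a, D a -> op e a = a /\ op a e = a.

Definition unital_groupoid_on (T : Type) (D : set T) (op : T -> T -> T) (e : T)
    : Prop :=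
  groupoid_on D op /\ neutral_on D op e.

(** Solutions are required to exist, not to be unique. *)
Definition quasigroup_on (T : Type) (D : set T) (op : T -> T -> T) (e : T)
    : Prop :=
  unital_groupoid_on D op e /\
  forall a b, D a -> D b ->
    (exists2 x, D x & op a x = b) /\ (exists2 x, D x & op x a = b).

Definition group_law (T : Type) (op : T -> T -> T) (e : T) : Prop :=
  [/\ unital_groupoid_on [set: T] op e,
      (forall a b c, op a (op b c) = op (op a b) c) &
      (forall a, exists b, op a b = e /\ op b a = e)].

(** * Quasirings and non-associative rings *)

(** The two one-sided laws are each quantified over the whole carrier before
    the disjunction is taken. *)
Record is_quasiring (T : Type) (add mul : T -> T -> T) (zero one : T) : Prop :=
  IsQuasiring {
    quasiring_add : quasigroup_on [set: T] add zero
                    \/ unital_groupoid_on [set: T] add zero;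
    quasiring_mul : quasigroup_on (~` [set zero]) mul one
                    \/ unital_groupoid_on (~` [set zero]) mul one;
    quasiring_mul0 : forall a, mul a zero = zero /\ mul zero a = zero;
    quasiring_distr :
      (forall a b c, mul a (add b c) = add (mul a b) (mul a c)) \/
      (forall a b c, mul (add b c) a = add (mul b a) (mul c a))
  }.

Definition is_nonassoc_ring (T : Type) (add mul : T -> T -> T) (zero one : T)
    : Prop :=
  [/\ is_quasiring add mul zero one,
      group_law add zero &
      quasigroup_on (~` [set zero]) mul one].

Record quasiring : Type := Quasiring {
  qr_sort :> Type;
  qr_add : qr_sort -> qr_sort -> qr_sort;
  qr_mul : qr_sort -> qr_sort -> qr_sort;
  qr_zero : qr_sort;
  qr_one : qr_sort;
  qr_axioms : is_quasiring qr_add qr_mul qr_zero qr_one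
}.

Arguments qr_zero {_}.
Arguments qr_one {_}.

(** A non-associative algebra over [F]; the linear-space axioms are those of
    [lmodType F]. *)
Record nonassoc_alg (F : fieldType) : Type := NonassocAlg {
  na_sort :> lmodType F;
  na_mul : na_sort -> na_sort -> na_sort;
  na_one : na_sort;
  na_ring : is_nonassoc_ring +%R na_mul 0 na_one;
  na_scaleAl : forall (c : F) a b, c *: na_mul a b = na_mul (c *: a) b;
  na_scaleAr : forall (c : F) a b, c *: na_mul a b = na_mul a (c *: b)
}.

(** * Substructures, ideals, simplicity, finite generation *)

(** Substructures need not contain [1]: otherwise [{0}] would not be an ideal.
    Finite generation does not depend on this choice, since [1] can be added to
    any finite family. *)
Definition subquasiring (K : quasiring) (A : set K) : Prop :=
  [/\ A qr_zero,
      (forall a b, A a -> A b -> A (qr_add a b)) &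
      (forall a b, A a -> A b -> A (qr_mul a b))].

Definition subalgebra (F : fieldType) (K : nonassoc_alg F) (A : set K) : Prop :=
  [/\ A 0,
      (forall a b, A a -> A b -> A (a + b)),
      (forall a b, A a -> A b -> A (na_mul a b)) &
      (forall (c : F) a, A a -> A (c *: a))].

Definition absorbing (T : Type) (mul : T -> T -> T) (A : set T) : Prop :=
  [set mul a b | a in A & b in [set: T]] `<=` A /\
  [set mul a b | a in [set: T] & b in A] `<=` A.

Definition qr_ideal (K : quasiring) (A : set K) : Prop :=
  subquasiring A /\ absorbing (@qr_mul K) A.

Definition na_ideal (F : fieldType) (K : nonassoc_alg F) (A : set K) : Prop :=
  subalgebra A /\ absorbing (@na_mul F K) A.

Definition qr_simple (K : quasiring) : Prop :=
  [set: K] <> [set qr_zero] /\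
  forall A : set K, qr_ideal A -> A = [set qr_zero] \/ A = [set: K].

Definition na_simple (F : fieldType) (K : nonassoc_alg F) : Prop :=
  [set: K] <> [set 0] /\
  forall A : set K, na_ideal A -> A = [set 0] \/ A = [set: K].

Definition qr_not_fg (K : quasiring) : Prop :=
  forall (m : nat) (a : 'I_m -> K),
    smallest (@subquasiring K) (range a) <> [set: K].

Definition na_not_fg (F : fieldType) (K : nonassoc_alg F) : Prop :=
  forall (m : nat) (a : 'I_m -> K),
    smallest (@subalgebra F K) (range a) <> [set: K].

(** * Homomorphisms, embeddings, isomorphisms *)

Record qr_hom (X K : quasiring) (f : X -> K) : Prop := QrHom {
  qr_homD : {morph f : a b / qr_add a b >-> qr_add a b};
  qr_homM : {morph f : a b / qr_mul a b >-> qr_mul a b};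
  qr_hom0 : f qr_zero = qr_zero;
  qr_hom1 : f qr_one = qr_one
}.

Record na_hom (F : fieldType) (X K : nonassoc_alg F) (f : X -> K) : Prop :=
  NaHom {
    na_homD : {morph f : a b / a + b};
    na_homZ : scalable f;
    na_homM : {morph f : a b / na_mul a b >-> na_mul a b};
    na_hom1 : f (na_one X) = na_one K
  }.

Definition qr_embedding (X K : quasiring) (f : X -> K) : Prop :=
  qr_hom f /\ injective f.

Definition na_embedding (F : fieldType) (X K : nonassoc_alg F) (f : X -> K)
    : Prop :=
  na_hom f /\ injective f.

Definition qr_isomorphic (X K : quasiring) : Prop :=
  exists f : X -> K, qr_hom f /\ bijective f.

Definition na_isomorphic (F : fieldType) (X K : nonassoc_alg F) : Prop :=
  exists f : X -> K, na_hom f /\ bijective f.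

(* Main.v *)
Require Import Defs.
From HB Require Import structures.
From mathcomp Require Import all_boot all_order all_algebra.
From mathcomp Require Import boolp classical_sets functions.

(** In both cases [K] is built so large that no map from [X] onto [K] exists, by
    Cantor's diagonal argument, and the work goes into keeping [K] simple.  One
    distributive law is available, and passing to the opposite multiplication
    exchanges the two laws, so it may be taken to be [a (b + c) = a b + a c].
    It then says that left multiplications are additive, and a multiplication on
    an additive structure [K] is the free choice, for each [a], of an additive
    map [k |-> a k] subject to a few conditions.

    Algebras.  Such an algebra is simple because it admits division
    ([nonassoc_alg_simple]), so it suffices to extend [X] to a larger algebra
    with division.  Let [K] be the space of families [idx -> X], with [X] placed
    in the coordinate [o].  Left multiplications must be linear automorphisms
    [N] with [N (emb x) = (a t * x)_t]; division on the other side asks, for all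
    nonzero [b] and [d], for some [a] with [a b = d].  If [b] lies in [X], this is
    solved coordinate by coordinate.  Otherwise the pair [(b, d)] is written into
    a single vector [tag b d], up to scalars an injective operation
    ([tag_inj]), and the left multiplication by [tag b d] is chosen to send [b]
    to [d] ([aut_two]).  The choices are made once on each line, so that the
    multiplication is homogeneous in [a] ([homogeneous_choice]).

    Quasirings.  Now a product of nonzero elements must be nonzero, but division
    is not available and simplicity must be arranged by hand.  Let [K] be the set
    of functions from infinite words over [X] to [X] that depend on a finite
    prefix, with [X] as the constants and pointwise addition.  Put
    [(a k)(w) = a w * k (s_a w)] with [s_a] a continuous self-map of words.
    Products of nonzero elements are nonzero because [s_a] maps the support of
    [a] onto all words, which is possible since the support contains a copy of
    the space of words.  Let [A] be an ideal containing [a <> 0].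
    The map [s_a] is arranged so that some product [a k] is a constant [x <> 0]
    on a clopen set [U] and zero elsewhere.  Since [X] is simple, the indicator
    of [U] is in [A].  For each proper clopen [U] and each of the two
    halves [P] of the space of words there is an element [code i U], from which
    [i] and [U] can be read off; its twist is arranged to send
    the indicator of [U] to that of [P].  The sum of the indicators of the two
    halves is [1], whence [A = K] ([ext_simple]). *)

Set Implicit Arguments.
Unset Strict Implicit.
Unset Printing Implicit Defensive.

Import GRing.Theory.
Local Open Scope classical_set_scope.

(** * Functions of infinite words that depend on a finite prefix *)

Section Words.

Variable Z : Type.
Implicit Types w u : nat -> Z.

Definition agree n w w' := forall i, i < n -> w i = w' i.

Definition finitary (Y : Type) (k : (nat -> Z) -> Y) :=
  exists n, forall w w', agree n w w' -> k w = k w'.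

Definition unif_cont (s : (nat -> Z) -> nat -> Z) :=
  forall n, exists m, forall w w', agree m w w' -> agree n (s w) (s w').

Definition shift n w : nat -> Z := fun i => w (n + i).

Definition splice n u w : nat -> Z := fun i => if i < n then u i else w (i - n).

Lemma agreeW m n w w' : m <= n -> agree n w w' -> agree m w w'.
Proof. by move=> mn h i im; apply: h; apply: leq_trans mn. Qed.

Lemma agree_sym n w w' : agree n w w' -> agree n w' w.
Proof. by move=> h i ?; rewrite h. Qed.

Lemma agree_trans n w1 w2 w3 : agree n w1 w2 -> agree n w2 w3 -> agree n w1 w3.
Proof. by move=> h h' i ?; rewrite h // h'. Qed.

Lemma agree_splice n u w : agree n u (splice n u w).
Proof. by move=> i ilt; rewrite /splice ilt. Qed.

Lemma shift_splice n u w : shift n (splice n u w) = w.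
Proof. by apply/funext => i; rewrite /shift /splice ltnNge leq_addr /= addKn. Qed.

Lemma agree_shift n m w w' : agree (n + m) w w' -> agree m (shift n w) (shift n w').
Proof. by move=> h i im; apply: h; rewrite ltn_add2l. Qed.

Lemma finitary2 (A B C : Type) (f : A -> B -> C) (k : (nat -> Z) -> A)
    (l : (nat -> Z) -> B) :
  finitary k -> finitary l -> finitary (fun w => f (k w) (l w)).
Proof.
move=> [n hk] [m hl]; exists (maxn n m) => w w' h.
rewrite (hk w w') ?(hl w w') //; apply: agreeW h.
  exact: leq_maxr.
exact: leq_maxl.
Qed.

Lemma finitary_cst (A : Type) (x : A) : finitary (fun _ => x).
Proof. by exists 0. Qed.

Lemma finitary1 (A B : Type) (f : A -> B) (k : (nat -> Z) -> A) :
  finitary k -> finitary (fun w => f (k w)).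
Proof. by move=> [n hk]; exists n => w w' /hk ->. Qed.

(** Uniform continuity is what makes precomposition preserve dependence on a
    finite prefix. *)
Lemma finitary_comp (A : Type) (k : (nat -> Z) -> A) s :
  finitary k -> unif_cont s -> finitary (fun w => k (s w)).
Proof. by move=> [n hk] /(_ n) [m hm]; exists m => w w' /hm /hk. Qed.

Lemma finitary_letter (A : Type) (f : Z -> A) i : finitary (fun w => f (w i)).
Proof. by exists i.+1 => w w' ->. Qed.

Lemma unif_cont_shift n : unif_cont (shift n).
Proof. by move=> m; exists (n + m) => w w'; apply: agree_shift. Qed.

Lemma unif_cont_id : unif_cont id.
Proof. by move=> m; exists m. Qed.

Lemma unif_cont_cst u : unif_cont (fun _ => u).
Proof. by move=> m; exists 0. Qed.

Lemma unif_cont_if (c : (nat -> Z) -> bool) s s' :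
  finitary c -> unif_cont s -> unif_cont s' ->
  unif_cont (fun w => if c w then s w else s' w).
Proof.
move=> [p hc] hs hs' n; have [m hm] := hs n; have [m' hm'] := hs' n.
exists (maxn p (maxn m m')) => w w' h.
have {h} [h1 h2 h3] : [/\ agree p w w', agree m w w' & agree m' w w'].
  split; apply: agreeW h; first exact: leq_maxl.
    by rewrite leq_max leq_maxl orbT.
  by rewrite leq_max leq_maxr orbT.
by rewrite (hc w w') //; case: ifP => _; [apply: hm | apply: hm'].
Qed.

Lemma finitary_agree n u : finitary (fun w => `[< agree n u w >]).
Proof.
exists n => w w' h; apply: asbool_equiv_eq; split=> h'.
  exact: agree_trans h' h.
exact: agree_trans h' (agree_sym h).
Qed.

End Words.

Arguments unif_cont_shift {Z} n.

(** * Opposite multiplication *)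

Section Opposite.

Variable T : Type.
Implicit Types (op add mul : T -> T -> T) (zero one : T).

Lemma unital_groupoid_on_op D op e :
  unital_groupoid_on D op e -> unital_groupoid_on D (fun x y : T => op y x) e.
Proof.
move=> [h [De he]]; split; first by move=> a b Da Db; apply: h.
by split=> // a /he [].
Qed.

Lemma quasigroup_on_op D op e :
  quasigroup_on D op e -> quasigroup_on D (fun x y : T => op y x) e.
Proof.
move=> [/unital_groupoid_on_op h hs]; split=> // a b Da Db.
by have [] := hs a b Da Db.
Qed.

Lemma is_quasiring_op add mul zero one :
  is_quasiring add mul zero one ->
  is_quasiring add (fun x y => mul y x) zero one.
Proof.
case=> hadd hmul h0 hd; split=> //.
- case: hmul => [/quasigroup_on_op|/unital_groupoid_on_op]; first by left.
  by right.
- by move=> a; have [] := h0 a.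
- by case: hd => hd; [right | left].
Qed.

Lemma absorbing_op mul (A : set T) :
  absorbing mul A -> absorbing (fun x y => mul y x) A.
Proof.
move=> [hl hr]; split=> _ [a Aa [b Ab <-]].
  by apply: hr; exists b => //; exists a.
by apply: hl; exists b => //; exists a.
Qed.

End Opposite.

Definition qr_op (K : quasiring) : quasiring :=
  Quasiring (is_quasiring_op (qr_axioms K)).

Lemma qr_simple_op (K : quasiring) : qr_simple K -> qr_simple (qr_op K).
Proof.
move=> [K0 Ks]; split=> // A [[A0 AD AM] Aabs]; apply: Ks; split.
  by split=> // a b Aa Ab; apply: (AM b a).
exact: (absorbing_op Aabs).
Qed.

Lemma qr_hom_op (X K : quasiring) (f : X -> K) :
  @qr_hom (qr_op X) K f <-> @qr_hom X (qr_op K) f.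
Proof. by split; case=> hD hM h0 h1; split=> // a b; apply: (hM b a). Qed.

Section AlgebraOpposite.

Variables (F : fieldType).

Lemma na_ring_op (K : nonassoc_alg F) :
  is_nonassoc_ring +%R (fun x y => @na_mul F K y x) 0%R (na_one K).
Proof.
have [hq hg hm] := na_ring K; split=> //; first exact: is_quasiring_op.
exact: quasigroup_on_op.
Qed.

Definition na_op (K : nonassoc_alg F) : nonassoc_alg F :=
  NonassocAlg (na_ring_op K) (fun c a b => na_scaleAr c b a)
    (fun c a b => na_scaleAl c b a).

Lemma na_hom_op (X K : nonassoc_alg F) (f : X -> K) :
  @na_hom F (na_op X) K f <-> @na_hom F X (na_op K) f.
Proof. by split; case=> hD hZ hM h1; split=> // a b; apply: (hM b a). Qed.

End AlgebraOpposite.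

(** * Enlarging a left distributive quasiring *)

Section QuasiringExtension.

Variable X : quasiring.
Hypothesis distr : forall a b c : X,
  qr_mul a (qr_add b c) = qr_add (qr_mul a b) (qr_mul a c).

Local Notation zero := (@qr_zero X).
Local Notation one := (@qr_one X).
Local Notation "a + b" := (@qr_add X a b).
Local Notation "a * b" := (@qr_mul X a b).
Local Notation word := (nat -> X).

Lemma qr_addP : unital_groupoid_on [set: X] (@qr_add X) zero.
Proof. by case: (quasiring_add (qr_axioms X)) => [[]|]. Qed.

Lemma qr_mulP : unital_groupoid_on (~` [set zero]) (@qr_mul X) one.
Proof. by case: (quasiring_mul (qr_axioms X)) => [[]|]. Qed.

Lemma qr_addr0 (a : X) : a + zero = a.
Proof. by have [_ [_ /(_ a I)[]]] := qr_addP. Qed.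

Lemma qr_add0r (a : X) : zero + a = a.
Proof. by have [_ [_ /(_ a I)[]]] := qr_addP. Qed.

Lemma qr_mulr0 (a : X) : a * zero = zero.
Proof. by case: (quasiring_mul0 (qr_axioms X) a). Qed.

Lemma qr_mul0r (a : X) : zero * a = zero.
Proof. by case: (quasiring_mul0 (qr_axioms X) a). Qed.

Lemma qr_mulr1 (a : X) : a * one = a.
Proof.
have [->|a0] := pselect (a = zero); first exact: qr_mul0r.
by have [_ [_ /(_ a a0)[]]] := qr_mulP.
Qed.

Lemma qr_mul1r (a : X) : one * a = a.
Proof.
have [->|a0] := pselect (a = zero); first exact: qr_mulr0.
by have [_ [_ /(_ a a0)[]]] := qr_mulP.
Qed.

Lemma qr_one_neq0 : one <> zero.
Proof. by have [_ []] := qr_mulP. Qed.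

Lemma qr_mul_neq0 (a b : X) : a <> zero -> b <> zero -> a * b <> zero.
Proof. by have [h _] := qr_mulP; apply: h. Qed.

Definition indic (U : word -> bool) (x : X) : word -> X :=
  fun w => if U w then x else zero.

Definition half (i : bool) (w : word) : bool := `[< w 0 = zero >] == i.

(** The element that will turn the indicator of [U] into that of [half i] by left
    multiplication.  It has to be one on [half i]; the copy of [U] in the other
    half records which [U] is meant. *)
Definition code (i : bool) (U : word -> bool) : word -> X :=
  indic (fun w => half i w || U (shift 1 w)) one.

Definition letter (i : bool) : X := if i then zero else one.

Definition cons_word (x : X) (w : word) : word := splice 1 (fun _ => x) w.

Lemma half_cons i j w : half i (cons_word (letter j) w) = (j == i).
Proof.
rewrite /half /cons_word /splice /= /letter; congr (_ == _).
case: j; first by rewrite asboolT.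
by rewrite asboolF //; apply: qr_one_neq0.
Qed.

Lemma shift_cons x w : shift 1 (cons_word x w) = w.
Proof. exact: shift_splice. Qed.

Lemma finitary_half i : finitary (half i).
Proof. exact: (finitary_letter (fun z => `[< z = zero >] == i) 0). Qed.

Lemma finitary_indic U x : finitary U -> finitary (indic U x).
Proof. exact: (finitary1 (fun b : bool => if b then x else zero)). Qed.

Lemma indic1_inj U V : indic U one = indic V one -> U = V.
Proof.
move=> h; apply/funext => w; move: (congr1 (fun f => f w) h); rewrite /indic.
case: (U w); case: (V w) => // e; first by case: qr_one_neq0.
by case: qr_one_neq0.
Qed.

(** The half that [code i U] fills completely is [i], because the copy of [U] in
    the other one is proper; the trace on that other half then gives [U]. *)
Lemma code_inj i i' U U' :
  (exists w, ~~ U w) -> (exists w, ~~ U' w) -> code i U = code i' U' ->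
  i = i' /\ U = U'.
Proof.
move=> [w0 Uw0] [w0' Uw0'] /indic1_inj e.
have eP w : half i w || U (shift 1 w) = half i' w || U' (shift 1 w).
  exact: (congr1 (fun f => f w) e).
have ii' : i = i'.
  apply/eqP; move: (eP (cons_word (letter i) w0')).
  by rewrite !half_cons shift_cons eqxx (negbTE Uw0') orbF /= => <-.
split=> //; apply/funext => w.
move: (eP (cons_word (letter (~~ i)) w)).
by rewrite !half_cons shift_cons -ii'; case: (i).
Qed.

Definition proper (U : word -> bool) :=
  [/\ finitary U, exists w, U w & exists w, ~~ U w].

(** The map [s] is fit to define the left multiplication
    [k |-> (w |-> a w * k (s w))].  The conditions ensure, in this order: that
    the product depends on a finite prefix; that constants multiply as in [X];
    that products of nonzero elements are nonzero; that the ideal generated by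
    [a] contains a nonzero multiple of an indicator; and that left multiplication
    by [code i U] turns the indicator of [U] into that of [half i]. *)
Record twist (a : word -> X) (s : word -> word) : Prop := Twist {
  twist_cont : unif_cont s;
  twist_cst : forall x, a = (fun _ => x) -> s = id;
  twist_onto : (exists w, a w <> zero) -> forall w',
    exists2 w, a w <> zero & s w = w';
  twist_localizes : (exists w, a w <> zero) -> exists (x : X) (V U : word -> bool),
    [/\ x <> zero, finitary V, finitary U, exists w, U w &
        (fun w => a w * indic V one (s w)) = indic U x];
  twist_spreads : forall i U, proper U -> a = code i U ->
    (fun w => a w * indic U one (s w)) = indic (half i) one }.

(** The identity serves for constants, which are never of the form
    [code i U] with [U] proper. *)
Lemma twist_of_cst x : twist (fun _ => x) id.
Proof.
split=> //; first exact: unif_cont_id.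
- by move=> [_ x0] w; exists w.
- move=> [_ x0]; exists x, (fun _ => true), (fun _ => true).
  split=> //; [exact: finitary_cst | exact: finitary_cst |].
  by apply/funext => w; rewrite /indic qr_mulr1.
- move=> i U [_ _ [w0 Uw0]] e; exfalso.
  have := congr1 (fun f => f (cons_word (letter i) w0)) e.
  have := congr1 (fun f => f (cons_word (letter (~~ i)) w0)) e.
  rewrite /= /code /indic !half_cons shift_cons (negbTE Uw0) eqxx.
  by case: (i) => /= -> /esym; apply: qr_one_neq0.
Qed.

(** Spreading requires that [s] map [half i] into [U] and send the other half
    outside [U].  Their images nevertheless cover all words: [half i]
    contains a copy of all words, retracted onto [U], and in the other half the
    support of [code i U] contains a cylinder, whose words are read after their
    prefix and retracted onto the complement of [U]. *)
Lemma twist_of_code i U : proper U -> exists s, twist (code i U) s.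
Proof.
move=> [[n Un] [wU UwU] [w1 Uw1]].
have finU : finitary U by exists n.
(* The prefix of length n.+1 is the letter marking the half followed by n
   letters that determine membership in U. *)
pose s w := if half i w
  then (if U (shift 1 w) then shift 1 w else wU)
  else if U (shift n.+1 w) then w1 else shift n.+1 w.
have contS : unif_cont s.
  apply: unif_cont_if (finitary_half i) _ _.
    apply: unif_cont_if.
    - exact: finitary_comp finU (unif_cont_shift _).
    - exact: unif_cont_shift.
    - exact: unif_cont_cst.
  apply: unif_cont_if.
  - exact: finitary_comp finU (unif_cont_shift _).
  - exact: unif_cont_cst.
  - exact: unif_cont_shift.
have spread : (fun w => code i U w * indic U one (s w)) = indic (half i) one.
  apply/funext => w; rewrite /code /indic /s; case: (half i w) => /=.
    by case E: (U (shift 1 w)); rewrite ?E ?UwU qr_mulr1.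
  by case E: (U (shift n.+1 w)); rewrite ?E ?(negbTE Uw1) qr_mulr0.
exists s; split=> //.
- move=> x e; exfalso.
  have := congr1 (fun f => f (cons_word (letter i) w1)) e.
  have := congr1 (fun f => f (cons_word (letter (~~ i)) w1)) e.
  rewrite /= /code /indic !half_cons shift_cons (negbTE Uw1) eqxx.
  by case: (i) => /= <- ; apply: qr_one_neq0.
- move=> _ w'; have [Uw'|Uw'] := boolP (U w').
    exists (cons_word (letter i) w').
      by rewrite /code /indic half_cons eqxx; apply: qr_one_neq0.
    by rewrite /s half_cons eqxx shift_cons Uw'.
  pose u := cons_word (letter (~~ i)) wU.
  exists (splice n.+1 u w').
    rewrite /code /indic (_ : U _); first by rewrite orbT; apply: qr_one_neq0.
    rewrite -(Un wU) // -[wU](shift_cons (letter (~~ i))).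
    exact/(@agree_shift _ 1)/agree_splice.
  rewrite /s shift_splice (negbTE Uw') (_ : half i _ = false) //.
  have -> : half i (splice n.+1 u w') = half i u by [].
  by rewrite half_cons; case: (i).
- move=> _; exists one, U, (half i); split=> //; first exact: qr_one_neq0.
    exact: finitary_half.
  by exists (cons_word (letter i) w1); rewrite half_cons eqxx.
- move=> i' U' [_ _ Uw1'] e.
  by have [<- <-] := code_inj (ex_intro _ w1 Uw1) Uw1' e.
Qed.

(** Near [u] the function [a] is a nonzero constant on a cylinder, and [s] reads
    the words of that cylinder after their prefix.  All other words go to the
    zero word, so that a function vanishing there, the indicator of
    [half false], is supported after twisting inside the cylinder. *)
Lemma twist_generic a u :
  finitary a -> a u <> zero -> (forall x, a <> fun _ => x) ->
  (forall i U, proper U -> a <> code i U) ->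
  exists s, twist a s.
Proof.
move=> [n an] au a_ncst a_ncode.
pose s w := if `[< agree n u w >] then shift n w else fun _ => zero.
have aS w' : a (splice n u w') = a u.
  by apply/esym/an/agree_splice.
have sS w' : s (splice n u w') = w'.
  by rewrite /s asboolT ?shift_splice //; apply: agree_splice.
exists s; split.
- apply: unif_cont_if; first exact: finitary_agree.
    exact: unif_cont_shift.
  exact: unif_cont_cst.
- by move=> x /a_ncst.
- by move=> _ w'; exists (splice n u w'); rewrite ?aS ?sS.
- move=> _; exists (a u), (half false).
  exists (fun w => `[< agree n u w >] && half false (shift n w)); split=> //.
  + exact: finitary_half.
  + apply: (finitary2 andb); first exact: finitary_agree.
    exact: finitary_comp (finitary_half _) (unif_cont_shift _).
  + exists (splice n u (cons_word (letter false) u)).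
    rewrite shift_splice half_cons eqxx andbT.
    exact/asboolP/agree_splice.
  + apply/funext => w; rewrite /s /indic.
    case: asboolP => [/an <-|_] /=.
      by case: ifP; rewrite ?qr_mulr1 ?qr_mulr0.
    by rewrite /half asboolT // qr_mulr0.
- by move=> i U pU /a_ncode.
Qed.

Lemma twist_exists a : finitary a -> exists s, twist a s.
Proof.
move=> fa.
have [[x ->]|a_ncst] := pselect (exists x, a = fun _ => x).
  by exists id; apply: twist_of_cst.
have [[i [U [pU ->]]]|a_ncode] := pselect (exists i U, proper U /\ a = code i U).
  exact: twist_of_code.
have [[u au]|a0] := pselect (exists u, a u <> zero); last first.
  case: a_ncst; exists zero; apply/funext => w; apply: contrapT => aw.
  by apply: a0; exists w.
apply: twist_generic fa au _ _ => [x e|i U pU e].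
  by apply: a_ncst; exists x.
by apply: a_ncode; exists i, U.
Qed.

Definition ext : Type := {k : word -> X | finitary k}.

Lemma ext_inj (k l : ext) : sval k = sval l -> k = l.
Proof. by case: k l => [k hk] [l hl] /= e; apply: eq_exist. Qed.

Definition ext_cst (x : X) : ext := exist _ _ (finitary_cst _ x).

Definition ext_add (k l : ext) : ext :=
  exist _ _ (finitary2 (@qr_add X) (svalP k) (svalP l)).

Definition twister (k : ext) : word -> word :=
  projT1 (cid (twist_exists (svalP k))).

Lemma twisterP k : twist (sval k) (twister k).
Proof. by rewrite /twister; case: cid. Qed.

Definition ext_mul (k l : ext) : ext :=
  exist _ _ (finitary2 (@qr_mul X) (svalP k)
               (finitary_comp (svalP l) (twist_cont (twisterP k)))).

Definition ext_indic U (fU : finitary U) x : ext :=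
  exist _ _ (finitary_indic x fU).

Lemma ext_mul_cstl x k w : sval (ext_mul (ext_cst x) k) w = x * sval k w.
Proof. by rewrite /= (twist_cst (twisterP (ext_cst x)) (erefl _)). Qed.

Lemma ext_neq0 k : k <> ext_cst zero -> exists w, sval k w <> zero.
Proof.
move=> k0; apply: contrapT => h; apply/k0/ext_inj/funext => w /=.
by apply: contrapT => kw; apply: h; exists w.
Qed.

Lemma ext_axioms : is_quasiring ext_add ext_mul (ext_cst zero) (ext_cst one).
Proof.
split.
- right; split=> //; split=> // a _.
  by split; apply/ext_inj/funext => w /=; rewrite ?qr_addr0 ?qr_add0r.
- right; split.
    move=> a b /ext_neq0 a0 /ext_neq0 [w bw] /(congr1 sval) /= e.
    have [v av sv] := twist_onto (twisterP a) a0 w.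
    have := congr1 (fun f => f v) e; rewrite /= sv.
    exact: qr_mul_neq0.
  split.
    move/(congr1 sval)/(congr1 (fun f => f (fun _ => zero))).
    exact: qr_one_neq0.
  move=> a _; split; apply/ext_inj/funext => w.
    by rewrite ext_mul_cstl qr_mul1r.
  by rewrite /= qr_mulr1.
- move=> a; split; apply/ext_inj/funext => w.
    by rewrite /= qr_mulr0.
  by rewrite ext_mul_cstl qr_mul0r.
- by left => a b c; apply/ext_inj/funext => w /=; rewrite distr.
Qed.

Definition ext_qr : quasiring := Quasiring ext_axioms.

Lemma ext_embedding : @qr_embedding X ext_qr ext_cst.
Proof.
split; last first.
  by move=> x y /(congr1 sval)/(congr1 (fun f => f (fun _ => zero))).
split=> //.
  by move=> a b; apply: ext_inj.
by move=> a b; apply/ext_inj/funext => w; rewrite ext_mul_cstl.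
Qed.

(** The diagonal argument applies to the functions of the first letter. *)
Lemma ext_not_isomorphic : ~ qr_isomorphic X ext_qr.
Proof.
move=> [f [_ [g gK fK]]].
pose d : ext := exist _ _ (finitary_letter
  (fun z => if `[< sval (f z : ext) (fun _ => z) = zero >] then one else zero) 0).
have := congr1 (fun k : ext => sval k (fun _ => g d)) (fK d).
rewrite /=; case: asboolP => [-> /esym /qr_one_neq0 //|h e].
by apply: h; rewrite e.
Qed.

Lemma ext_simple : qr_simple X -> qr_simple ext_qr.
Proof.
move=> [_ Xsimple]; split.
  move=> e; have : [set: ext_qr] (ext_cst one) by [].
  rewrite e => /(congr1 sval)/(congr1 (fun f => f (fun _ => zero))).
  exact: qr_one_neq0.
move=> A [[A0 AD _] [Ar Al]].
have {}Ar (a b : ext) : A a -> A (ext_mul a b).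
  by move=> Aa; apply: Ar; exists a => //; exists b.
have {}Al (a b : ext) : A b -> A (ext_mul a b).
  by move=> Ab; apply: Al; exists a => //; exists b.
have [Atriv|] := pselect (forall a, A a -> a = ext_cst zero).
  by left; apply/seteqP; split=> [a /Atriv|a ->].
move=> /existsNP [a /not_implyP [Aa /ext_neq0 a0]]; right.
(* The ideal contains a nonzero multiple of an indicator. *)
have [x [V [U [x0 fV fU [u Uu] aVU]]]] := twist_localizes (twisterP a) a0.
have AxU : A (ext_indic fU x).
  suff -> : ext_indic fU x = ext_mul a (ext_indic fV one) by apply: Ar.
  by apply: ext_inj; rewrite /= -aVU.
(* The y such that y times that indicator lies in A form an ideal of X. *)
have AU : A (ext_indic fU one).
  pose B : set X := fun y => A (ext_indic fU y).
  have BI : qr_ideal B.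
    split; first split; rewrite /B.
    - suff -> : ext_indic fU zero = ext_cst zero by [].
      by apply/ext_inj/funext => w /=; rewrite /indic; case: ifP.
    - move=> y z Ay Az.
      suff -> : ext_indic fU (y + z)
        = ext_add (ext_indic fU y) (ext_indic fU z) by apply: AD.
      by apply/ext_inj/funext => w /=; rewrite /indic; case: ifP; rewrite ?qr_addr0.
    - move=> y z Ay _.
      suff -> : ext_indic fU (y * z)
        = ext_mul (ext_indic fU y) (ext_cst z) by apply: Ar.
      by apply/ext_inj/funext => w /=; rewrite /indic; case: ifP; rewrite ?qr_mul0r.
    - split=> _ [y By [z Bz <-]]; rewrite /B in By Bz *.
        suff -> : ext_indic fU (y * z)
          = ext_mul (ext_indic fU y) (ext_cst z) by apply: Ar.
        apply/ext_inj/funext => w /=; rewrite /indic.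
        by case: ifP; rewrite ?qr_mul0r.
      suff -> : ext_indic fU (y * z)
        = ext_mul (ext_cst y) (ext_indic fU z) by apply: Al.
      apply/ext_inj/funext => w; rewrite ext_mul_cstl /= /indic.
      by case: ifP; rewrite ?qr_mulr0.
  case: (Xsimple _ BI) => BE; last by have : B one by rewrite BE.
  by have : B x by []; rewrite BE => /x0.
(* From one indicator to those of the two halves, whose sum is the constant
   one. *)
have A1 : A (ext_cst one).
  have [Uall|/existsNP [v Uv]] := pselect (forall w, U w).
    suff <- : ext_indic fU one = ext_cst one by [].
    by apply/ext_inj/funext => w /=; rewrite /indic Uall.
  have pU : proper U by split=> //; [exists u | exists v; apply/negP].
  have Ahalf i : A (ext_indic (finitary_half i) one).
    have fc : finitary (code i U).
      apply: finitary_indic; apply: (finitary2 orb (finitary_half i)).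
      exact: finitary_comp fU (unif_cont_shift 1).
    pose b : ext := exist _ _ fc.
    suff -> : ext_indic (finitary_half i) one = ext_mul b (ext_indic fU one).
      exact: Al.
    by apply: ext_inj; rewrite /= -(twist_spreads (twisterP b) pU (erefl _)).
  suff -> : ext_cst one
    = ext_add (ext_indic (finitary_half true) one)
              (ext_indic (finitary_half false) one).
    exact: AD.
  apply/ext_inj/funext => w /=; rewrite /indic /half.
  by case: (`[< w _ = zero >]); rewrite /= ?qr_addr0 ?qr_add0r.
apply/seteqP; split=> // k _.
suff -> : k = ext_mul (ext_cst one) k by apply: Ar.
by apply/ext_inj/funext => w; rewrite ext_mul_cstl qr_mul1r.
Qed.

End QuasiringExtension.

(** * Choosing one solution on each line *)

Section HomogeneousChoice.

Variables (F : fieldType) (V W : lmodType F) (P : V -> W -> Prop).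
Hypothesis P_ex : forall a, a <> 0%R -> exists y, P a y.
Hypothesis P_hom : forall (c : F) a y, c <> 0%R -> P a y -> P (c *: a)%R (c *: y)%R.

Local Open Scope ring_scope.

(** A representative is chosen on each line, a solution is chosen there, and it
    is carried to the rest of the line by scaling; the scalar is determined by the
    point because representatives are nonzero. *)
Lemma homogeneous_choice :
  exists f : V -> W, (forall a, a <> 0 -> P a (f a)) /\
                     forall c a, f (c *: a) = c *: f a.
Proof.
pose line a : set V := [set b | exists2 c : F, c <> 0 & b = c *: a].
have lineZ (c : F) a : c <> 0 -> line (c *: a) = line a.
  move=> c0; apply/seteqP; split=> b [d d0 ->].
    exists (d * c); last by rewrite scalerA.
    by move/eqP; rewrite mulf_eq0 => /orP[]/eqP.
  exists (d * c^-1); last by rewrite scalerA mulfVK //; apply/eqP.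
  by move/eqP; rewrite mulf_eq0 invr_eq0 => /orP[]/eqP.
pose rep a := xget 0 (line a).
have repZ (c : F) a : c <> 0 -> rep (c *: a) = rep a.
  by move=> c0; rewrite /rep lineZ.
have repP a : exists2 c : F, c <> 0 & rep a = c *: a.
  apply: (xgetPex 0 (P := line a)); exists a, 1; last by rewrite scale1r.
  by apply/eqP; rewrite oner_eq0.
have /choice [g gP] : forall a, exists y, a <> 0 -> P a y.
  move=> a; have [->|/P_ex [y Py]] := pselect (a = 0); first by exists 0.
  by exists y.
have /choice [mu muP] : forall a, exists c : F,
    [/\ a <> 0 -> c <> 0, a = c *: rep a & a = 0 -> c = 0].
  move=> a; have [->|a0] := pselect (a = 0).
    by exists 0; rewrite scale0r.
  have [c c0 e] := repP a; exists c^-1; split=> //.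
    by move=> _ /eqP; rewrite invr_eq0 => /eqP.
  by rewrite e scalerA mulVf ?scale1r //; apply/eqP.
have mu0 : mu 0 = 0 by have [_ _] := muP 0; apply.
have rep_neq0 a : a <> 0 -> rep a <> 0.
  by move=> a0 r0; have [_ e _] := muP a; apply: a0; rewrite e r0 scaler0.
exists (fun a => mu a *: g (rep a)); split.
  move=> a a0; have [/(_ a0) m0 e _] := muP a.
  by rewrite {1}e; apply: P_hom => //; apply/gP/rep_neq0.
move=> c a; have [->|c0] := pselect (c = 0); first by rewrite !scale0r mu0 scale0r.
have [->|a0] := pselect (a = 0); first by rewrite scaler0 mu0 scale0r scaler0.
rewrite repZ // scalerA; congr (_ *: _).
have [_ e _] := muP a; have [_ e' _] := muP (c *: a).
apply/eqP; rewrite -subr_eq0; apply/eqP; apply: contrapT => d0.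
apply: (rep_neq0 _ a0).
have : (mu (c *: a) - c * mu a) *: rep a = 0.
  by rewrite scalerBl -scalerA -e -{1}(repZ _ _ c0) -e' subrr.
move/(congr1 (fun v => (mu (c *: a) - c * mu a)^-1 *: v)).
by rewrite scalerA mulVf ?scale1r ?scaler0 //; apply/eqP.
Qed.

End HomogeneousChoice.

(** * Enlarging a left distributive algebra *)

(** The index set contains two disjoint blocks, each with a flag and two copies
    of the whole index set, so that a pair of families over [coord T] fits into
    either block of a single family.  The constructor [Base] provides one
    coordinate for [X] and enough others for the diagonal argument. *)
Inductive coord (T : Type) : Type :=
| Base of T
| Flag of bool
| Copy of bool & bool & coord T.

Section AlgebraExtension.

Local Open Scope ring_scope.

Variables (F : fieldType) (X : nonassoc_alg F).
Hypothesis distr : forall a b c : X,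
  na_mul a (b + c) = na_mul a b + na_mul a c.

Local Notation "x ** y" := (@na_mul F X x y) (at level 40, left associativity).
Local Notation one := (na_one X).
Local Notation idx := (coord X).
Local Notation V := (idx -> X).
Implicit Types (a b d k : V) (s t : idx) (x y : X).

Lemma na_mulP : quasigroup_on (~` [set 0]) (@na_mul F X) one.
Proof. by have [] := na_ring X. Qed.

Lemma na_one_neq0 : one <> 0.
Proof. by have [[_ []]] := na_mulP. Qed.

Lemma na_mulr0 x : x ** 0 = 0.
Proof. by have [h _ _] := na_ring X; case: (quasiring_mul0 h x). Qed.

Lemma na_mul0r x : 0 ** x = 0.
Proof. by have [h _ _] := na_ring X; case: (quasiring_mul0 h x). Qed.

Lemma na_mulr1 x : x ** one = x.
Proof.
have [->|x0] := pselect (x = 0); first exact: na_mul0r.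
by have [[_ [_ /(_ x x0)[]]]] := na_mulP.
Qed.

Lemma na_mul1r x : one ** x = x.
Proof.
have [->|x0] := pselect (x = 0); first exact: na_mulr0.
by have [[_ [_ /(_ x x0)[]]]] := na_mulP.
Qed.

Lemma na_mul_neq0 x y : x <> 0 -> y <> 0 -> x ** y <> 0.
Proof. by have [[h _] _] := na_mulP; apply: h. Qed.

Lemma na_solver x y : x <> 0 -> exists z, x ** z = y.
Proof.
have [->|y0] := pselect (y = 0); first by exists 0; rewrite na_mulr0.
by move=> x0; have [_ /(_ x y x0 y0) [[z _ e] _]] := na_mulP; exists z.
Qed.

Lemma na_solvel x y : x <> 0 -> exists z, z ** x = y.
Proof.
have [->|y0] := pselect (y = 0); first by exists 0; rewrite na_mul0r.
by move=> x0; have [_ /(_ x y x0 y0) [_ [z _ e]]] := na_mulP; exists z.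
Qed.

Record lin_aut (N : V -> V) : Prop := LinAut {
  aut_add : {morph N : a b / a + b};
  aut_scale : scalable N;
  aut_ker : forall a, N a = 0 -> a = 0;
  aut_surj : forall b, exists a, N a = b }.

Lemma aut_sub N a b : lin_aut N -> N (a - b) = N a - N b.
Proof.
by move=> hN; rewrite -scaleN1r (aut_add hN) (aut_scale hN) scaleN1r.
Qed.

Lemma aut_inj N : lin_aut N -> injective N.
Proof.
move=> hN a b e; apply/eqP; rewrite -subr_eq0; apply/eqP; apply: (aut_ker hN).
by rewrite aut_sub // e subrr.
Qed.

Lemma aut_comp N N' : lin_aut N -> lin_aut N' -> lin_aut (fun k => N (N' k)).
Proof.
move=> h h'; split.
- by move=> a b; rewrite (aut_add h') (aut_add h).
- by move=> c a; rewrite (aut_scale h') (aut_scale h).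
- by move=> a /(aut_ker h)/(aut_ker h').
- move=> b; have [a <-] := aut_surj h b.
  by have [a' <-] := aut_surj h' a; exists a'.
Qed.

Lemma aut_inv N : lin_aut N ->
  exists N', [/\ lin_aut N', (forall k, N (N' k) = k) & forall k, N' (N k) = k].
Proof.
move=> h; have [N' NN'] := choice (aut_surj h).
have N'N k : N' (N k) = k by apply: (aut_inj h); rewrite NN'.
exists N'; split=> //; split.
- by move=> a b; apply: (aut_inj h); rewrite (aut_add h) !NN'.
- by move=> c a; apply: (aut_inj h); rewrite (aut_scale h) !NN'.
- by move=> a e; rewrite -(NN' a) e -{1}(scale0r a) (aut_scale h) scale0r.
- by move=> b; exists (N b).
Qed.

Lemma aut_scaling (c : F) N : c <> 0 -> lin_aut N -> lin_aut (fun k => c *: N k).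
Proof.
move=> /eqP c0 h; split.
- by move=> a b; rewrite (aut_add h) scalerDr.
- by move=> d a; rewrite (aut_scale h) !scalerA mulrC.
- move=> a e; apply: (aut_ker h).
  by rewrite -[N a]scale1r -(mulVf c0) -scalerA e scaler0.
- move=> b; have [a e] := aut_surj h (c^-1 *: b); exists a.
  by rewrite e scalerA mulfV // scale1r.
Qed.

Lemma aut_perm (p q : idx -> idx) :
  cancel p q -> cancel q p -> lin_aut (fun k t => k (p t)).
Proof.
move=> pq qp; split=> //.
- move=> a e; apply/funext => t; move/(congr1 (fun f => f (q t))): e.
  by rewrite /= qp.
- by move=> b; exists (b \o q); apply/funext => t; rewrite /= pq.
Qed.

Definition delta s x : V := fun t => if `[< t = s >] then x else 0.

Lemma deltaE s x : delta s x s = x.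
Proof. by rewrite /delta asboolT. Qed.

Lemma delta_neq s x t : t <> s -> delta s x t = 0.
Proof. by move=> ts; rewrite /delta asboolF. Qed.

Definition rscale a x : V := fun t => a t ** x.

(** The matrix whose column [s] is [a] and which is the identity elsewhere. *)
Definition column s a : V -> V :=
  fun k t => if `[< t = s >] then a s ** k s else k t + a t ** k s.

Lemma column_delta s a x : column s a (delta s x) = rscale a x.
Proof.
apply/funext => t; rewrite /column deltaE /rscale; case: asboolP => [->//|ts].
by rewrite delta_neq // add0r.
Qed.

Lemma column_fix s a k : k s = 0 -> column s a k = k.
Proof.
move=> ks; apply/funext => t; rewrite /column ks !na_mulr0.
by case: asboolP => [->|_]; rewrite ?ks ?addr0.
Qed.

(** The equation in coordinate [s] involves [k s] alone and is solved by division
    in [X]; the other coordinates follow by subtraction. *)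
Lemma aut_column s a : a s <> 0 -> lin_aut (column s a).
Proof.
move=> as0; split.
- move=> k l; apply/funext => t; rewrite /column !fctE.
  by case: asboolP => _; rewrite distr // addrACA.
- move=> c k; apply/funext => t; rewrite /column !fctE.
  by case: asboolP => _; rewrite -na_scaleAr ?scalerDr.
- move=> k e; have ks : k s = 0.
    apply: contrapT => ks; apply: (na_mul_neq0 as0 ks).
    by move/(congr1 (fun f => f s)): e; rewrite /column asboolT.
  by rewrite -e column_fix.
- move=> b; have [x xE] := na_solver (b s) as0.
  exists (fun t => if `[< t = s >] then x else b t - a t ** x).
  apply/funext => t; rewrite /column; rewrite (asboolT (erefl s)).
  by case: asboolP => [->//|_]; rewrite subrK.
Qed.

Lemma neq0_coord a : a <> 0 -> exists s, a s <> 0.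
Proof.
move=> a0; apply: contrapT => h; apply/a0/funext => t.
by apply: contrapT => at0; apply: h; exists t.
Qed.

Definition swap s t (u : idx) : idx :=
  if `[< u = s >] then t else if `[< u = t >] then s else u.

Lemma swapK s t : cancel (swap s t) (swap s t).
Proof.
by move=> u; rewrite /swap; do !case: asboolP => //=; congruence.
Qed.

Lemma swapl s t : swap s t s = t.
Proof. by rewrite /swap asboolT. Qed.

Lemma swap_other s t u : u <> s -> u <> t -> swap s t u = u.
Proof. by move=> us ut; rewrite /swap !asboolF. Qed.

(** Two transpositions: the first takes [o] to [r], the second takes the new
    position of [p] to [s], which leaves [r] in place. *)
Lemma perm2_exists o p r s : o <> p -> r <> s ->
  exists f g : idx -> idx, [/\ cancel f g, cancel g f, f o = r & f p = s].
Proof.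
move=> op rs; pose f u := swap (swap o r p) s (swap o r u).
have p'r : r <> swap o r p.
  by rewrite -{1}(swapl o r) => /(can_inj (swapK o r)).
exists f, (fun u => swap o r (swap (swap o r p) s u)); rewrite /f; split.
- by move=> u; rewrite !swapK.
- by move=> u; rewrite !swapK.
- by rewrite swapl swap_other.
- by rewrite swapl.
Qed.

Lemma aut_move o p r s : o <> p -> r <> s ->
  exists N, [/\ lin_aut N, (forall x, N (delta o x) = delta r x)
    & forall x, N (delta p x) = delta s x].
Proof.
move=> op rs; have [f [g [fg gf fo fp]]] := perm2_exists op rs.
exists (fun k t => k (g t)); split; first exact: aut_perm gf fg.
- move=> x; apply/funext => t; rewrite /delta; congr (if _ then _ else _).
  apply: asbool_equiv_eq; rewrite -fo; split=> [<-|->]; last exact: fg.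
  by rewrite gf.
- move=> x; apply/funext => t; rewrite /delta; congr (if _ then _ else _).
  apply: asbool_equiv_eq; rewrite -fp; split=> [<-|->]; last exact: fg.
  by rewrite gf.
Qed.

Local Notation o := (Base (0 : X)).

Definition emb x : V := delta o x.

Lemma embP a : a = emb (a o) <-> forall t, t <> o -> a t = 0.
Proof.
split=> [-> t ?|h]; first exact: delta_neq.
apply/funext => t; have [->|to] := pselect (t = o); first by rewrite /emb deltaE.
by rewrite /emb delta_neq // h.
Qed.

Lemma aut_one a : a <> 0 ->
  exists2 N, lin_aut N & forall x, N (emb x) = rscale a x.
Proof.
move=> /neq0_coord [r ar].
have [s rs] : exists s, r <> s.
  by case: (pselect (r = Flag _ true)) => [->|?]; [exists o | exists (Flag _ true)].
have of0 : o <> Flag _ true by [].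
have [N [hN No _]] := aut_move of0 rs.
exists (fun k => column r a (N k)); first exact: aut_comp (aut_column ar) hN.
by move=> x; rewrite No column_delta.
Qed.

(** In the basis of coordinates, [b] is first carried to [delta p one] by the
    inverse of a column matrix, which fixes [emb x] since [p <> o]; coordinates
    [o] and [p] are moved to [r] and [s]; then the columns [r] and [s] are
    replaced by [a] and [d].  The last replacement leaves [a] alone because
    [a s = 0]. *)
Lemma aut_two a b d p s :
  a <> 0 -> a s = 0 -> d s <> 0 -> p <> o -> b p <> 0 ->
  exists N, [/\ lin_aut N, (forall x, N (emb x) = rscale a x) & N b = d].
Proof.
move=> /neq0_coord [r ar] as0 ds po bp.
have rs : r <> s by move=> e; rewrite e in ar.
have sr : s <> r by move=> e; rewrite e in rs.
have op : o <> p by move=> e; rewrite e in po.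
have [N [hN No Np]] := aut_move op rs.
have [C [hC CK KC]] := aut_inv (aut_column bp).
have Co x : C (emb x) = emb x.
  by rewrite -{1}(@column_fix p b (emb x)) ?KC // /emb delta_neq.
have Cb : C b = delta p one.
  rewrite -[in C b](_ : column p b (delta p one) = b) ?KC // column_delta.
  by apply/funext => t; rewrite /rscale na_mulr1.
exists (fun k => column s d (column r a (N (C k)))); split.
- apply: aut_comp (aut_column ds) _; apply: aut_comp (aut_column ar) _.
  exact: aut_comp hN hC.
- move=> x; rewrite Co No column_delta column_fix // /rscale as0.
  exact: na_mul0r.
- rewrite Cb Np (@column_fix r); last by rewrite delta_neq.
  by rewrite column_delta; apply/funext => t; rewrite /rscale na_mulr1.
Qed.

Definition block t : bool :=
  match t with Base _ => false | Flag i => i | Copy i _ _ => i end.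

(** A block that misses some coordinate where [d] is nonzero: the block
    [true] if [d] is nonzero outside it. *)
Definition free_block d : bool := `[< exists2 s, d s <> 0 & block s = false >].

(** The block used depends on [d], so as to leave room for a coordinate where
    [tag b d] vanishes and [d] does not; [aut_two] needs one. *)
Definition tag b d : V := fun t =>
  match t with
  | Base _ => 0
  | Flag i => if i == free_block d then one else 0
  | Copy i j u => if i == free_block d then (if j then b u else d u) else 0
  end.

Lemma tag_support d b : d <> 0 -> exists2 s, d s <> 0 & tag b d s = 0.
Proof.
move=> /neq0_coord [s ds].
have off u : block u != free_block d -> tag b d u = 0.
  by case: u => //= [i|i j u] /negbTE ->.
case E: (free_block d).
  have [u du bu] := asboolW E.
  by exists u => //; apply: off; rewrite bu E.
exists s => //; apply: off; rewrite E; apply/eqP => bs.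
by case/asboolP: (negbT E); exists s.
Qed.

Lemma tag_flag b d : tag b d (Flag _ (free_block d)) = one.
Proof. by rewrite /= eqxx. Qed.

Lemma tag_neq0 b d : tag b d <> 0.
Proof.
move/(congr1 (fun f => f (Flag _ (free_block d)))); rewrite /= eqxx.
exact: na_one_neq0.
Qed.

Lemma tag_not_emb b d x : tag b d <> emb x.
Proof.
move/(congr1 (fun f => f (Flag _ (free_block d)))).
rewrite tag_flag /emb delta_neq //.
exact: na_one_neq0.
Qed.

(** The position of the nonzero flag gives the block, its value gives the scalar,
    and the copies in the block give the two families. *)
Lemma tag_inj (c c' : F) b b' d d' : c <> 0 -> c' <> 0 ->
  c *: tag b d = c' *: tag b' d' -> [/\ c = c', b = b' & d = d'].
Proof.
move=> /eqP c0 /eqP c'0 e.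
have /eqP one0 := na_one_neq0.
have eP t : c *: tag b d t = c' *: tag b' d' t by exact: (congr1 (fun f => f t) e).
have ff : free_block d = free_block d'.
  apply/eqP; have := eP (Flag _ (free_block d)); rewrite tag_flag /=.
  case: eqP => // _ /eqP; rewrite scaler0 scaler_eq0.
  by rewrite (negbTE c0) (negbTE one0).
have cc' : c = c'.
  have := eP (Flag _ (free_block d)); rewrite /= ff eqxx => /eqP.
  rewrite -subr_eq0 -scalerBl scaler_eq0 (negbTE one0) orbF subr_eq0.
  by move/eqP.
split=> //; apply/funext => u.
  have := eP (Copy (free_block d) true u); rewrite /= ff eqxx cc'.
  exact: scalerI.
have := eP (Copy (free_block d) false u); rewrite /= ff eqxx cc'.
exact: scalerI.
Qed.

(** The requirements on the left multiplication by [a].  The second one makes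
    division by elements of [X] a matter of coordinates; the third one makes [X]
    act coordinatewise, so that [emb] is multiplicative; the fourth one makes
    division by all other [b] possible.  All are stable under scaling [a] and
    [N] together. *)
Record left_mult a (N : V -> V) : Prop := LeftMult {
  left_mult_aut : lin_aut N;
  left_mult_emb : forall x, N (emb x) = rscale a x;
  left_mult_cst : forall x, a = emb x -> N = fun k t => x ** k t;
  left_mult_tag : forall c b d, c <> 0 -> d <> 0 -> b <> emb (b o) ->
    a = c *: tag b d -> N b = c *: d }.

Lemma emb_inj : injective emb.
Proof. by move=> x y /(congr1 (fun f => f o)); rewrite /emb !deltaE. Qed.

Lemma scale_emb (c : F) x : c *: emb x = emb (c *: x).
Proof.
apply/funext => t; rewrite !fctE /emb /delta.
by case: ifP => _; rewrite ?scaler0.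
Qed.

Lemma left_mult_hom (c : F) a N : c <> 0 -> left_mult a N ->
  left_mult (c *: a) (fun k => c *: N k).
Proof.
move=> c0 [h1 h2 h3 h4]; have /eqP cn := c0.
have sc (y z : V) : c *: z = y -> z = c^-1 *: y.
  by move<-; rewrite scalerA mulVf ?scale1r.
split.
- exact: aut_scaling.
- by move=> x; rewrite h2; apply/funext => t; rewrite /rscale !fctE na_scaleAl.
- move=> x e; have ae : a = emb (c^-1 *: x) by rewrite -scale_emb; apply: sc.
  rewrite (h3 _ ae); apply/funext => k; apply/funext => t; rewrite !fctE.
  by rewrite na_scaleAl scalerA mulfV // scale1r.
- move=> c' b d c'0 d0 be e.
  have ae : a = (c^-1 * c') *: tag b d by rewrite -scalerA; apply: sc.
  rewrite (h4 _ _ _ _ d0 be ae) ?scalerA ?mulVKf //.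
  by move/eqP; rewrite mulf_eq0 invr_eq0 (negbTE cn) => /eqP.
Qed.

Lemma left_mult_of_emb x : x <> 0 -> left_mult (emb x) (fun k t => x ** k t).
Proof.
move=> x0; split.
- split.
  + by move=> a b; apply/funext => t; rewrite !fctE distr.
  + by move=> c a; apply/funext => t; rewrite !fctE na_scaleAr.
  + move=> a e; apply/funext => t; apply: contrapT => at0.
    by apply: (na_mul_neq0 x0 at0); move/(congr1 (fun f => f t)): e.
  + move=> b; have /choice [a ab] := fun t => na_solver (b t) x0.
    by exists a; apply/funext.
- move=> y; apply/funext => t; rewrite /rscale /emb /delta.
  by case: ifP; rewrite ?na_mulr0 ?na_mul0r.
- by move=> y /emb_inj ->.
- move=> c b d c0 d0 be e; exfalso; apply: (@tag_not_emb b d (c^-1 *: x)).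
  by rewrite -scale_emb e scalerA mulVf ?scale1r //; apply/eqP.
Qed.

(** The requirements never conflict: no tag lies in [X], and by [tag_inj] at most
    one triple [(c, b, d)] constrains a given [a]. *)
Lemma left_mult_exists a : a <> 0 -> exists N, left_mult a N.
Proof.
move=> a0; have [[x ax]|aX] := pselect (exists x, a = emb x).
  exists (fun k t => x ** k t); rewrite ax; apply: left_mult_of_emb.
  move=> x0; apply: a0; rewrite ax x0; apply/funext => t.
  by rewrite /emb /delta; case: ifP.
have [[c [b [d [c0 d0 bX ae]]]]|a_ntag] := pselect (exists c b d,
    [/\ c <> 0, d <> 0, b <> emb (b o) & a = c *: tag b d]); last first.
  have [N hN Ne] := aut_one a0; exists N; split=> //.
    by move=> x e; case: aX; exists x.
  by move=> c b d c0 d0 bX ae; case: a_ntag; exists c, b, d.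
have [s ds ts] := tag_support b d0.
have [p po bp] : exists2 p, p <> o & b p <> 0.
  apply: contrapT => h; apply/bX/embP => t to; apply: contrapT => bt.
  by apply: h; exists t.
have [N [hN Ne Nb]] := aut_two (@tag_neq0 b d) ts ds po bp.
exists (fun k => c *: N k); split.
- exact: aut_scaling.
- move=> x; rewrite Ne ae; apply/funext => t.
  by rewrite /rscale !fctE na_scaleAl.
- by move=> x e; case: aX; exists x.
- move=> c' b' d' c'0 _ _; rewrite ae => /(tag_inj c0 c'0) [<- <- <-].
  by rewrite Nb.
Qed.

Lemma left_mult_system : exists f : V -> V -> V,
  (forall a, a <> 0 -> left_mult a (f a)) /\
  forall (c : F) a k, f (c *: a) k = c *: f a k.
Proof.
have [f [fP fZ]] := @homogeneous_choice F V (V -> V : lmodType F) left_mult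
  left_mult_exists left_mult_hom.
by exists f; split=> // c a k; rewrite fZ.
Qed.

Definition ext_na_mul : V -> V -> V := projT1 (cid left_mult_system).

Lemma ext_na_mulP a : a <> 0 -> left_mult a (ext_na_mul a).
Proof. by move: a; rewrite /ext_na_mul; case: cid => f []. Qed.

Lemma ext_na_mulZl (c : F) a k : ext_na_mul (c *: a) k = c *: ext_na_mul a k.
Proof. by rewrite /ext_na_mul; case: cid => f []. Qed.

Lemma ext_na_mul0l k : ext_na_mul 0 k = 0.
Proof. by rewrite -{1}(scale0r 0) ext_na_mulZl scale0r. Qed.

Lemma ext_na_mulZr (c : F) a k : ext_na_mul a (c *: k) = c *: ext_na_mul a k.
Proof.
have [->|/ext_na_mulP h] := pselect (a = 0); first by rewrite !ext_na_mul0l scaler0.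
by rewrite (aut_scale (left_mult_aut h)).
Qed.

Lemma ext_na_mul0r a : ext_na_mul a 0 = 0.
Proof. by rewrite -{1}(scale0r 0) ext_na_mulZr scale0r. Qed.

Lemma ext_na_mulDr a k l : ext_na_mul a (k + l) = ext_na_mul a k + ext_na_mul a l.
Proof.
have [->|/ext_na_mulP h] := pselect (a = 0); first by rewrite !ext_na_mul0l addr0.
by rewrite (aut_add (left_mult_aut h)).
Qed.

Lemma emb0 : emb 0 = 0.
Proof. by apply/funext => t; rewrite /emb /delta; case: ifP. Qed.

Lemma ext_na_mul_embr a x : ext_na_mul a (emb x) = rscale a x.
Proof.
have [->|/ext_na_mulP h] := pselect (a = 0); last exact: (left_mult_emb h).
by rewrite ext_na_mul0l; apply/funext => t; rewrite /rscale na_mul0r.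
Qed.

Lemma ext_na_mul_embl x k : ext_na_mul (emb x) k = fun t => x ** k t.
Proof.
have [x0|/ext_na_mulP h] := pselect (emb x = 0); last first.
  by rewrite (left_mult_cst h (erefl _)).
have -> : x = 0 by apply: emb_inj; rewrite x0 emb0.
by rewrite emb0 ext_na_mul0l; apply/funext => t; rewrite na_mul0r.
Qed.

Lemma ext_na_mul_quasigroup : quasigroup_on (~` [set 0]) ext_na_mul (emb one).
Proof.
split; first split.
- move=> a b a0 b0 e; apply: b0.
  by apply: (aut_ker (left_mult_aut (ext_na_mulP a0)) e).
- split; first by rewrite /= -emb0 => /emb_inj/na_one_neq0.
  move=> a _; split.
    by rewrite ext_na_mul_embl; apply/funext => t; rewrite na_mul1r.
  by rewrite ext_na_mul_embr; apply/funext => t; rewrite /rscale na_mulr1.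
- move=> a b a0 b0; split.
    have [k e] := aut_surj (left_mult_aut (ext_na_mulP a0)) b; exists k => // k0.
    by apply: b0; rewrite -e k0 ext_na_mul0r.
  suff [k e] : exists k, ext_na_mul k a = b.
    by exists k => // k0; apply: b0; rewrite -e k0 ext_na_mul0l.
  have [aX|aX] := pselect (a = emb (a o)).
    have ao : a o <> 0 by move=> e; apply: a0; rewrite aX e emb0.
    have /choice [k kb] := fun t => na_solvel (b t) ao.
    by exists k; rewrite aX ext_na_mul_embr; apply/funext.
  exists (tag a b).
  have h := left_mult_tag (ext_na_mulP (@tag_neq0 a b)) (c := 1) _ b0 aX.
  rewrite h ?scale1r //.
  by apply/eqP; rewrite oner_eq0.
Qed.

Lemma addV_unital : unital_groupoid_on [set: V] +%R 0.
Proof. by split=> //; split=> // a _; rewrite add0r addr0. Qed.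

Lemma ext_na_mul_ring : is_nonassoc_ring +%R ext_na_mul 0 (emb one).
Proof.
split; last exact: ext_na_mul_quasigroup.
  split.
  - by right; exact: addV_unital.
  - by left; exact: ext_na_mul_quasigroup.
  - by move=> a; rewrite ext_na_mul0l ext_na_mul0r.
  - by left => a b c; rewrite ext_na_mulDr.
split; first exact: addV_unital.
  by move=> a b c; rewrite addrA.
by move=> a; exists (- a); rewrite subrr addNr.
Qed.

Definition ext_na : nonassoc_alg F :=
  @NonassocAlg F (V : lmodType F) ext_na_mul (emb one) ext_na_mul_ring
    (fun c a b => esym (ext_na_mulZl c a b))
    (fun c a b => esym (ext_na_mulZr c a b)).

Lemma ext_na_embedding : @na_embedding F X ext_na emb.
Proof.
split; last exact: emb_inj.
split=> //.
- move=> x y; apply/funext => t; rewrite /emb /delta /GRing.add /=.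
  by case: ifP => _; rewrite ?addr0.
- by move=> c x; rewrite -scale_emb.
- move=> x y; rewrite /= ext_na_mul_embl; apply/funext => t; rewrite /emb /delta.
  by case: ifP => _; rewrite ?na_mulr0.
Qed.

(** The diagonal argument applies to the coordinates [Base y]. *)
Lemma ext_na_not_isomorphic : ~ na_isomorphic X ext_na.
Proof.
move=> [f [_ [g gK fK]]].
pose k : V := fun t =>
  if t is Base y then if `[< (f y : V) t = 0 >] then one else 0 else 0.
have : (f (g k) : V) (Base (g k)) = k (Base (g k)) by rewrite fK.
by rewrite [RHS]/k; case: asboolP => // -> /esym /na_one_neq0.
Qed.

End AlgebraExtension.

(** A nonzero element of an ideal can be multiplied to any other element. *)
Lemma nonassoc_alg_simple (F : fieldType) (K : nonassoc_alg F) : na_simple K.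
Proof.
have [hq _ [[_ [one0 _]] hdiv]] := na_ring K.
split=> [e|A [[A0 _ _ _] [Ar _]]].
  by apply: one0; rewrite -e.
have [Atriv|] := pselect (forall a, A a -> a = 0%R).
  by left; apply/seteqP; split=> [a /Atriv|a ->].
move=> /existsNP [a /not_implyP [Aa a0]]; right.
apply/seteqP; split=> // b _.
have [->//|b0] := pselect (b = 0%R).
have [[x _ <-] _] := hdiv a b a0 b0.
by apply: Ar; exists a => //; exists x.
Qed.

(** * Both distributive laws *)

Theorem theorem2p10 :
  (forall (F : fieldType) (X : nonassoc_alg F),
     na_simple X -> na_not_fg X ->
     exists (K : nonassoc_alg F) (f : X -> K),
       na_simple K /\ na_embedding f /\ ~ na_isomorphic X K)
  /\
  (forall X : quasiring,
     qr_simple X -> qr_not_fg X ->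
     exists (K : quasiring) (f : X -> K),
       qr_simple K /\ qr_embedding f /\ ~ qr_isomorphic X K).
Proof.
split=> [F X _ _|X Xsimple _].
  have [Xquasi _ _] := na_ring X.
  case: (quasiring_distr Xquasi) => distr.
    exists (ext_na distr), (@emb F X); split; first exact: nonassoc_alg_simple.
    by split; [exact: ext_na_embedding | exact: ext_na_not_isomorphic].
  pose K := @ext_na F (na_op X) (fun a b c => distr a b c).
  exists (na_op K), (@emb F (na_op X)); split; first exact: nonassoc_alg_simple.
  have [hom inj] := @ext_na_embedding F (na_op X) (fun a b c => distr a b c).
  split; first by split=> //; apply/na_hom_op.
  move=> [g [/na_hom_op ghom gbij]].
  by apply: (@ext_na_not_isomorphic F (na_op X) (fun a b c => distr a b c)); exists g.
case: (quasiring_distr (qr_axioms X)) => distr.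
  exists (ext_qr distr), (@ext_cst X); split; first exact: ext_simple.
  by split; [exact: ext_embedding | exact: ext_not_isomorphic].
pose K := @ext_qr (qr_op X) (fun a b c => distr a b c).
exists (qr_op K), (@ext_cst (qr_op X)).
split; first exact/qr_simple_op/ext_simple/qr_simple_op.
have [hom inj] := @ext_embedding (qr_op X) (fun a b c => distr a b c).
split; first by split=> //; apply/qr_hom_op.
move=> [g [/qr_hom_op ghom gbij]].
by apply: (@ext_not_isomorphic (qr_op X) (fun a b c => distr a b c)); exists g.
Qed.
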